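(* For each deterministic algorithm $A$ for Metric $1$-median that makes $O(n)$ queries on $n$-point inputs, there is a sufficiently small constant $\delta>0$ such that $A$ is not $(\delta\log n)$-approximate; that is, it is not the case that on every $n$-point metric space $(M,d)$ the output $p$ of $A$ satisfies $\sum_{y\in M}d(p,y)\le\delta\log n\cdot\min_{q\in M}\sum_{y\in M}d(q,y)$.
   Context: Metric $1$-median: given an $n$-point metric space $(M,d)$ (the point set $M$ is known to the algorithm, while $d$ is accessible only through queries, each query asking for $d(x,y)$ for some $x,y\in M$, possibly chosen adaptively), output a point $p\in M$. An algorithm is $\gamma(n)$-approximate if on every $n$-point metric space its output $p$ satisfies $\sum_{y\in M}d(p,y)\le\gamma(n)\min_{q\in M}\sum_{y\in M}d(q,y)$. *)

(* Defs.v *)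
From HB Require Import structures.
From mathcomp Require Import all_boot all_order all_algebra.
From mathcomp Require Import all_classical all_reals all_analysis.

Set Implicit Arguments.
Unset Strict Implicit.
Unset Printing Implicit Defensive.

Import Order.TTheory GRing.Theory Num.Theory.
Local Open Scope ring_scope.

Definition is_metric (R : realType) (M : Type) (d : M -> M -> R) : Prop :=
  [/\ forall x y, 0 <= d x y,
      forall x y, d x y = 0 <-> x = y,
      forall x y, d x y = d y x &
      forall x y z, d x z <= d x y + d y z].

(* A deterministic adaptive algorithm on the fixed point set M: it either
   outputs a point, or queries a pair and continues according to the answer.
   No computability is required of the continuation. *)
Inductive query_tree (R : realType) (M : Type) : Type :=
| Output (p : M)
| Query (x y : M) (next : R -> query_tree R M).

Fixpoint output (R : realType) (M : Type) (t : query_tree R M)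
    (d : M -> M -> R) : M :=
  match t with
  | Output p => p
  | Query x y next => output (next (d x y)) d
  end.

Fixpoint num_queries (R : realType) (M : Type) (t : query_tree R M)
    (d : M -> M -> R) : nat :=
  match t with
  | Output _ => 0
  | Query x y next => (num_queries (next (d x y)) d).+1
  end.

(* The point set is part of the input. It must be assumed nonempty, since
   query_tree R M is empty when M is, and without the assumption there would
   be no algorithm at all. *)
Definition algorithm (R : realType) : Type :=
  forall M : finType, (0 < #|M|)%N -> query_tree R M.

Definition makes_linear_queries (R : realType) (A : algorithm R) : Prop :=
  exists C N : nat, forall (M : finType) (M_gt0 : (0 < #|M|)%N)
      (d : M -> M -> R),
    (N <= #|M|)%N -> is_metric d -> (num_queries (A M M_gt0) d <= C * #|M|)%N.

Definition cost (R : realType) (M : finType) (d : M -> M -> R) (p : M) : R :=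
  \sum_(y : M) d p y.

(* The seed of the iterated minimum is itself one of the costs, so this is the
   minimum of the costs over M, for any choice of p0. *)
Definition min_cost (R : realType) (M : finType) (d : M -> M -> R) (p0 : M)
  : R := \big[Num.min/cost d p0]_(q : M) cost d q.

(* The approximation guarantee at one given size n, with ratio c = gamma(n). *)
Definition approximate_at (R : realType) (A : algorithm R) (n : nat) (c : R)
  : Prop :=
  forall (M : finType) (M_gt0 : (0 < #|M|)%N) (d : M -> M -> R),
    #|M| = n -> is_metric d ->
    let p := output (A M M_gt0) d in cost d p <= c * min_cost d p.

(* Main.v *)
(** An adversary answers the queries while maintaining an integer metric [D],
    initially [L = Theta(log n)] between distinct points, and heights [h >= 1]
    that are 1-Lipschitz for [D]. The true distance is
    [min (D x y) (h x + h y)], as if a virtual hub lay at distance [h x] from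
    each [x]; hence the cheapest point costs at most [2 * sum h]. The query
    [(a, b)] is answered by this distance, which then becomes an edge of [D].
    No answer is altered later: heights only grow, and a new edge has length
    either [D a b], which changes nothing, or [h a + h b], and then by the
    Lipschitz condition a path through it from [x] to [y] has length at least
    [h x + h y].

    The height of [a] is raised by one (the raise spreading to other points by
    the Lipschitz condition) once [a] has received, at its current height [k],
    as many edges as there are points in the open ball of radius [k] around it.
    Only points of that ball are raised, so each query pays for O(1) of [sum h],
    and O(n) queries keep [sum h = O(n)]. On the other hand at most
    [#|ball a k|] edges were made at height [k], and they have length at least
    [k + 1], so ball sizes obey the Catalan recursion
    [N (r + 1) <= 1 + sum_k N k * N (r - k)] and grow at most like [4 ^ r].
    When the algorithm outputs [p], raising [p] to height [L] is therefore cheap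
    and puts most points at distance at least [L] from [p]. *)

Require Import Defs.
From HB Require Import structures.
From mathcomp Require Import all_boot all_order all_algebra.
From mathcomp Require Import all_classical all_reals all_analysis.
From mathcomp Require Import fintype finset zify ring lra.

Import Order.TTheory GRing.Theory Num.Theory.

Set Implicit Arguments.
Unset Strict Implicit.
Unset Printing Implicit Defensive.

Local Open Scope nat_scope.
Local Open Scope set_scope.

Lemma sum_nat_mem (T : finType) (A : {pred T}) : \sum_x (x \in A : nat) = #|A|.
Proof.
by rewrite -sum1_card [RHS]big_mkcond; apply: eq_bigr => x _; case: ifP.
Qed.

Lemma leq_card_bigcup (I T : finType) (P : {pred I}) (F : I -> {set T}) :
  #|\bigcup_(i in P) F i| <= \sum_(i in P) #|F i|.
Proof.
apply: (big_ind2 (fun (A : {set T}) n => #|A| <= n)) => [|A m B n Am Bn|//].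
  by rewrite cards0.
by apply: leq_trans (leq_card_setU A B) (leq_add Am Bn).
Qed.

(** * Natural-valued metrics *)

Record nat_metric (M : eqType) (D : M -> M -> nat) : Prop := NatMetric {
  nat_dist_eq0 : forall x y, (D x y == 0) = (x == y);
  nat_dist_sym : forall x y, D x y = D y x;
  nat_dist_triangle : forall x y z, D x z <= D x y + D y z }.

Lemma nat_distxx (M : eqType) (D : M -> M -> nat) x : nat_metric D -> D x x = 0.
Proof. by case=> D_eq0 _ _; apply/eqP; rewrite D_eq0. Qed.

Definition uniform_dist (M : eqType) (L : nat) (x y : M) : nat := L * (x != y).

Lemma nat_metric_uniform_dist (M : eqType) L :
  0 < L -> nat_metric (@uniform_dist M L).
Proof.
rewrite /uniform_dist => L_gt0; split=> [x y|x y|x y z].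
- by rewrite muln_eq0 eqb0 negbK eqn0Ngt L_gt0.
- by rewrite eq_sym.
- rewrite -mulnDr leq_mul2l; apply/orP; right.
  by have [->|_] := eqVneq x y; rewrite ?leq_b1 // (leq_trans (leq_b1 _)).
Qed.

Definition link (M : Type) (D : M -> M -> nat) (a b : M) (w : nat)
    (x y : M) : nat :=
  minn (D x y) (minn (D x a + w + D b y) (D x b + w + D a y)).

Lemma linkC (M : Type) (D : M -> M -> nat) a b w x y :
  link D a b w x y = link D b a w x y.
Proof. by rewrite /link [minn (_ + _ + _) _]minnC. Qed.

Lemma leq_link (M : Type) (D : M -> M -> nat) a b w x y :
  link D a b w x y <= D x y.
Proof. exact: geq_minl. Qed.

Lemma leq_link_via (M : Type) (D : M -> M -> nat) a b w x y :
  link D a b w x y <= D x a + w + D b y.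
Proof. by rewrite /link; lia. Qed.

Lemma nat_metric_link (M : eqType) (D : M -> M -> nat) a b w :
  nat_metric D -> (w = 0 -> a = b) -> nat_metric (link D a b w).
Proof.
move=> D_metric w_eq0; have [D_eq0 D_sym D_tri] := D_metric.
split=> [x y|x y|x y z]; rewrite /link.
- apply/eqP/eqP => [link0|->]; last by rewrite nat_distxx ?min0n.
  have eqD u v : D u v = 0 -> u = v by move=> /eqP; rewrite D_eq0 => /eqP.
  have [/eqD //|via] : D x y = 0 \/
      (D x a + w + D b y = 0 \/ D x b + w + D a y = 0) by lia.
  have ab : a = b by apply: w_eq0; lia.
  by rewrite -ab in via; transitivity a; apply: eqD; lia.
- by rewrite (D_sym y x) (D_sym y a) (D_sym y b) (D_sym a x) (D_sym b x); lia.
- move: (D_tri x y z) (D_tri x a z) (D_tri x b z) (D_tri x y a) (D_tri x y b).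
  by move: (D_tri a y z) (D_tri b y z) (D_sym y a) (D_sym y b); lia.
Qed.

Lemma is_metric_natr (R : realType) (M : eqType) (D : M -> M -> nat) :
  nat_metric D -> is_metric (fun x y => (D x y)%:R%R : R).
Proof.
move=> D_metric; have [D_eq0 D_sym D_tri] := D_metric.
split=> [x y|x y|x y|x y z].
- exact: ler0n.
- by split=> [/eqP|->]; [rewrite pnatr_eq0 D_eq0 => /eqP | rewrite nat_distxx].
- by rewrite D_sym.
- by rewrite -natrD ler_nat.
Qed.

(** * Heights and the virtual hub *)

Record height_function (M : Type) (D : M -> M -> nat) (h : M -> nat) : Prop :=
  HeightFunction {
    height_gt0 : forall x, 0 < h x;
    height_lipschitz : forall x y, h x <= h y + D x y }.

Definition hub_dist (M : Type) (D : M -> M -> nat) (h : M -> nat) (x y : M) :=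
  minn (D x y) (h x + h y).

Lemma nat_metric_hub_dist (M : eqType) (D : M -> M -> nat) h :
  nat_metric D -> height_function D h -> nat_metric (hub_dist D h).
Proof.
move=> [D_eq0 D_sym D_tri] [h_gt0 h_lip].
split=> [x y|x y|x y z]; rewrite /hub_dist.
- by rewrite -D_eq0; have := h_gt0 x; lia.
- by rewrite D_sym addnC.
- by move: (D_tri x y z) (h_lip x y) (h_lip z y) (D_sym z y); lia.
Qed.

Lemma height_function_hub_dist (M : Type) (D : M -> M -> nat) h :
  height_function D h -> height_function (hub_dist D h) h.
Proof.
move=> [h_gt0 h_lip]; split=> // x y.
by have := h_lip x y; rewrite /hub_dist; lia.
Qed.

Lemma height_function_link (M : Type) (D : M -> M -> nat) h a b w :
    height_function D h -> h a <= h b + w -> h b <= h a + w ->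
  height_function (link D a b w) h.
Proof.
move=> [h_gt0 h_lip] hab hba; split=> // x y; rewrite /link.
by move: (h_lip x y) (h_lip x a) (h_lip x b) (h_lip a y) (h_lip b y); lia.
Qed.

(* Holds for every pair whose distance has been answered. *)
Definition settled (M : Type) (D : M -> M -> nat) (h : M -> nat) (x y : M) :=
  D x y <= h x + h y.

Lemma hub_dist_settled (M : Type) (D : M -> M -> nat) h x y :
  settled D h x y -> hub_dist D h x y = D x y.
Proof. exact: minn_idPl. Qed.

Lemma link_hub_dist_settled (M : eqType) (D : M -> M -> nat) h a b x y :
    nat_metric D -> height_function D h -> settled D h x y ->
  link D a b (hub_dist D h a b) x y = D x y.
Proof.
move=> [_ D_sym D_tri] [_ h_lip]; rewrite /settled /link /hub_dist.
move: (D_tri x a b) (D_tri x b y) (D_tri x b a) (D_tri x a y).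
move: (D_sym a b) (D_sym y a) (D_sym y b).
by move: (h_lip x a) (h_lip x b) (h_lip y a) (h_lip y b); lia.
Qed.

(** * Growth of balls *)

Definition oball (M : finType) (D : M -> M -> nat) (x : M) (r : nat)
  : {set M} := [set y | D x y < r].

Lemma oball_hub_dist (M : finType) (D : M -> M -> nat) h x r :
  r <= h x -> oball (hub_dist D h) x r = oball D x r.
Proof. by move=> rh; apply/setP => y; rewrite !inE /hub_dist; lia. Qed.

Lemma sub_oball_link (M : finType) (D : M -> M -> nat) a b w x r :
  oball D x r \subset oball (link D a b w) x r.
Proof.
apply/subsetP => y; rewrite !inE; apply: leq_ltn_trans; exact: leq_link.
Qed.

(* [E x k] holds edges out of [x] of length more than [k], and every distance
   below [L] is realized by a path that starts with such an edge. *)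
Definition steps_along (M : finType) (L : nat) (D : M -> M -> nat)
    (E : M -> nat -> {set M}) : Prop :=
  forall x y, x != y -> D x y < L ->
    exists k, exists2 z, z \in E x k & D z y + k < D x y.

Lemma card_oballS (M : finType) L (D : M -> M -> nat) E x r :
    steps_along L D E -> r < L ->
  #|oball D x r.+1| <=
    1 + \sum_(k < r.+1) \sum_(z in E x k) #|oball D z (r - k)|.
Proof.
move=> step rL.
pose reach (k : 'I_r.+1) := \bigcup_(z in E x k) oball D z (r - k).
have sub : oball D x r.+1 \subset x |: \bigcup_(k in 'I_r.+1) reach k.
  apply/subsetP => y; rewrite !inE => ltD.
  have [//|nyx] := eqVneq y x.
  have [||k [z zE ltz]] := step x y; first by rewrite eq_sym.
    exact: leq_trans ltD rL.
  have kr : k < r.+1 by lia.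
  apply/bigcupP; exists (Ordinal kr) => //; apply/bigcupP; exists z => //.
  by rewrite inE /=; lia.
apply: leq_trans (subset_leq_card sub) _; rewrite cardsU1.
apply: leq_add (leq_b1 _) (leq_trans (leq_card_bigcup _ _) _).
by apply: leq_sum => k _; apply: leq_card_bigcup.
Qed.

Local Open Scope ring_scope.

Lemma sum_convolution (R : pzSemiRingType) (u v : nat -> R) r :
  \sum_(i < r) \sum_(k < i.+1) u k * v (i - k)%N =
  \sum_(k < r) u k * \sum_(j < r - k) v j.
Proof.
elim: r => [|r IH]; first by rewrite !big_ord0.
rewrite big_ord_recr /= IH [RHS]big_ord_recr /= subSnn big_ord1.
rewrite [X in _ + X]big_ord_recr /= subnn addrA -big_split /=; congr (_ + _).
apply: eq_bigr => k _; rewrite -mulrDr; congr (_ * _).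
by rewrite subSn 1?ltnW // big_ord_recr.
Qed.

(* If the generating function of [u] is at most 1 up to some order, then the
   recursion bounds it by [(1 - x) + x * 1 ^ 2] one order further. *)
Lemma sum_le1_convolution_rec (R : numDomainType) (x : R) (c u : nat -> R) L :
    0 <= x -> (forall i, 0 <= u i) -> u 0%N = 0 ->
    (forall i, (i < L)%N ->
       u i.+1 <= c i + x * \sum_(k < i.+1) u k * u (i - k)%N) ->
    (forall r, \sum_(i < r) c i <= 1 - x) ->
  forall r, (r <= L.+1)%N -> \sum_(i < r) u i <= 1.
Proof.
move=> x_ge0 u_ge0 u0 rec sum_c.
elim/ltn_ind => -[|r] IH rL; first by rewrite big_ord0.
have conv_le1 : \sum_(i < r) \sum_(k < i.+1) u k * u (i - k)%N <= 1.
  rewrite sum_convolution; apply: le_trans (IH r (leqnn _) (ltnW rL)).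
  apply: ler_sum => k _; rewrite ler_piMr // IH ?ltnS ?leq_subr //.
  exact: leq_trans (leq_subr _ _) (ltnW rL).
rewrite big_ord_recl u0 add0r.
have le_rec (i : 'I_r) : true ->
    u (lift ord0 i) <= c i + x * \sum_(k < i.+1) u k * u (i - k)%N.
  by move=> _; apply: rec (leq_trans (ltn_ord i) rL).
apply: le_trans (ler_sum _ le_rec) _; rewrite big_split -mulr_sumr /=.
by rewrite -[leRHS](subrK x) lerD ?sum_c ?ler_piMr.
Qed.

(* At [x = 1/4] the weights [c i = x ^ i.+1] sum to [1/3 <= 1 - x]. *)
Lemma leq_exp4_convolution_rec (N : nat -> nat) (L : nat) :
    N 0 = 0%N ->
    (forall r, r < L -> N r.+1 <= 1 + \sum_(k < r.+1) N k * N (r - k))%N ->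
  forall r, (r <= L)%N -> (N r <= 4 ^ r)%N.
Proof.
move=> N0 rec r rL.
pose x : rat := 4%:R^-1; pose u i : rat := (N i)%:R * x ^+ i.
have x_ge0 : 0 <= x by rewrite invr_ge0.
have u_ge0 i : 0 <= u i by rewrite mulr_ge0 ?exprn_ge0.
have u_rec i : (i < L)%N ->
    u i.+1 <= x ^+ i.+1 + x * \sum_(k < i.+1) u k * u (i - k)%N.
  move=> /rec; rewrite -(ler_nat rat) natrD natr_sum => le_N.
  apply: le_trans (ler_wpM2r (exprn_ge0 i.+1 x_ge0) le_N) _.
  rewrite mulrDl mul1r lerD2l exprS mulrCA mulr_suml.
  rewrite le_eqVlt; apply/predU1P; left; congr (_ * _).
  by apply: eq_bigr => k _; rewrite natrM /u mulrACA -exprD subnKC // -ltnS.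
have geometric n : \sum_(i < n) x ^+ i.+1 <= 1 - x.
  under eq_bigr do rewrite exprS.
  have := subrX1 x n; have := exprn_ge0 n x_ge0; rewrite -mulr_sumr /x; lra.
have u0 : u 0%N = 0 by rewrite /u N0 mul0r.
have := sum_le1_convolution_rec x_ge0 u_ge0 u0 u_rec geometric.
move=> /(_ r.+1 rL); rewrite big_ord_recr /= => sum_le1; have : u r <= 1.
  by apply: le_trans sum_le1; rewrite lerDr sumr_ge0.
by rewrite /u /x exprVn ler_pdivrMr ?exprn_gt0 // mul1r -natrX ler_nat.
Qed.

Local Close Scope ring_scope.

Lemma card_oball_leq_exp4 (M : finType) L (D : M -> M -> nat) E x r :
    steps_along L D E -> (forall y k, #|E y k| <= #|oball D y k|) -> r <= L ->
  #|oball D x r| <= 4 ^ r.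
Proof.
move=> step deg rL; pose N k := \max_y #|oball D y k|.
have le_N y k : #|oball D y k| <= N k by exact: leq_bigmax.
apply: leq_trans (le_N x r) _; move: r rL.
apply: leq_exp4_convolution_rec => [|r rL].
  by apply: big1 => y _; apply: eq_card0 => z; rewrite inE.
apply/bigmax_leqP => y _; apply: leq_trans (card_oballS _ step rL) _.
rewrite leq_add2l; apply: leq_sum => k _.
apply: leq_trans (leq_mul (leq_trans (deg y k) (le_N y k)) (leqnn _)).
by rewrite -sum_nat_const; apply: leq_sum => z _.
Qed.

(** * The adversary *)

(* [edges s x k] is the set of points joined to [x] while its height was [k]. *)
Record config (M : finType) := Config {
  base_dist : M -> M -> nat;
  height : M -> nat;
  edges : M -> nat -> {set M} }.

Record valid (M : finType) (L : nat) (s : config M) : Prop := Valid {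
  valid_metric : nat_metric (base_dist s);
  valid_height : height_function (base_dist s) (height s);
  valid_steps : steps_along L (base_dist s) (edges s);
  valid_card_edges : forall x k, #|edges s x k| <= #|oball (base_dist s) x k|;
  valid_edges_above : forall x k, height s x < k -> edges s x k = set0 }.

Definition has_room (M : finType) (s : config M) (x : M) : bool :=
  #|edges s x (height s x)| < #|oball (base_dist s) x (height s x)|.

Definition potential (M : finType) (s : config M) : nat :=
  \sum_x (height s x + #|edges s x (height s x)|).

Definition extends (M : finType) (s s' : config M) : Prop :=
  forall x y, settled (base_dist s) (height s) x y ->
    base_dist s' x y = base_dist s x y /\
    settled (base_dist s') (height s') x y.

Lemma extends_trans (M : finType) (s1 s2 s3 : config M) :
  extends s1 s2 -> extends s2 s3 -> extends s1 s3.
Proof. by move=> e12 e23 x y /e12 [<- /e23 []]. Qed.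

Definition init (M : finType) (L : nat) : config M :=
  Config (@uniform_dist M L) (fun=> 1) (fun _ _ => set0).

Lemma valid_init (M : finType) L : 0 < L -> valid L (init M L).
Proof.
move=> L_gt0; split=> //=; first exact: nat_metric_uniform_dist.
- by move=> x y nxy; rewrite /uniform_dist nxy muln1 ltnn.
- by move=> x k; rewrite cards0.
Qed.

Lemma potential_init (M : finType) L : potential (init M L) = #|M|.
Proof.
by rewrite /potential /=; under eq_bigr do rewrite cards0; rewrite sum1_card.
Qed.

(** ** Raising heights *)

Definition raise_height (M : Type) (D : M -> M -> nat) (h : M -> nat) (z : M)
  (v : nat) (y : M) : nat := maxn (h y) (v - D z y).

Lemma leq_raise_height (M : Type) (D : M -> M -> nat) h z v y :
  h y <= raise_height D h z v y.
Proof. exact: leq_maxl. Qed.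

Lemma leq_raise_height_center (M : eqType) (D : M -> M -> nat) h z v :
  nat_metric D -> v <= raise_height D h z v z.
Proof.
by move=> D_metric; rewrite /raise_height nat_distxx // subn0 leq_maxr.
Qed.

Lemma height_function_raise_height (M : eqType) (D : M -> M -> nat) h z v :
    nat_metric D -> height_function D h ->
  height_function D (raise_height D h z v).
Proof.
move=> [_ _ D_tri] [h_gt0 h_lip]; split=> [x|x y].
  exact: leq_trans (h_gt0 x) (leq_raise_height _ _ _ _ _).
by move: (h_lip x y) (D_tri z x y); rewrite /raise_height; lia.
Qed.

Lemma sum_raise_height (M : finType) (D : M -> M -> nat) h z v :
  \sum_y raise_height D h z v y <= \sum_y h y + v * #|oball D z v|.
Proof.
rewrite -sum_nat_mem big_distrr -big_split; apply: leq_sum => y _ /=.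
by rewrite inE /raise_height; lia.
Qed.

Lemma raise_heightS_leq (M : finType) (D : M -> M -> nat) h z y :
    height_function D h ->
  raise_height D h z (h z).+1 y <= h y + (y \in oball D z (h z)).
Proof.
move=> [h_gt0 h_lip].
by move: (h_lip z y) (h_gt0 y); rewrite inE /raise_height; lia.
Qed.

Definition raise (M : finType) (s : config M) (z : M) (v : nat) : config M :=
  Config (base_dist s) (raise_height (base_dist s) (height s) z v) (edges s).

Lemma extends_raise (M : finType) (s : config M) z v : extends s (raise s z v).
Proof.
move=> x y sxy; split=> //; apply: leq_trans sxy _.
by rewrite leq_add ?leq_raise_height.
Qed.

Section ValidRaise.
Variables (M : finType) (L : nat) (s : config M).
Hypothesis s_valid : valid L s.

Lemma valid_raise z v : valid L (raise s z v).
Proof.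
case: s_valid => D_metric h_height step deg above; split=> //=.
  exact: height_function_raise_height.
move=> x k ltk; apply: above; apply: leq_ltn_trans ltk.
exact: leq_raise_height.
Qed.

Lemma has_room_raise_lt z v x :
  height s x < height (raise s z v) x -> has_room (raise s z v) x.
Proof.
move=> lt_h; rewrite /has_room (valid_edges_above s_valid) // cards0.
apply/card_gt0P; exists x; rewrite inE (nat_distxx _ (valid_metric s_valid)).
exact: leq_ltn_trans (leq0n _) lt_h.
Qed.

Lemma has_room_raise z v x : has_room s x -> has_room (raise s z v) x.
Proof.
move=> room_x; have := leq_raise_height (base_dist s) (height s) z v x.
rewrite leq_eqVlt => /orP[/eqP eq_h|]; last exact: has_room_raise_lt.
by rewrite /has_room /= -eq_h.
Qed.

(* Every raised point starts afresh without edges; forgetting those of [z]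
   pays for the points that are raised. *)
Lemma potential_raise z :
  ~~ has_room s z -> potential (raise s z (height s z).+1) <= potential s.
Proof.
case: s s_valid => D h E [/= D_metric h_height _ _ above].
rewrite /has_room /potential !big_split /= -leqNgt => full.
set h' := raise_height _ _ _ _.
have edges_le y : #|E y (h' y)| <= #|E y (h y)|.
  have := leq_raise_height D h z (h z).+1 y; rewrite -/h' leq_eqVlt.
  by move=> /orP[/eqP <- //|/above ->]; rewrite cards0.
have edges_z : #|E z (h' z)| = 0.
  by rewrite above ?cards0 //; apply: leq_raise_height_center.
have sum_edges : \sum_y #|E y (h' y)| + #|E z (h z)| <= \sum_y #|E y (h y)|.
  rewrite (bigD1 z) // [leqRHS](bigD1 z) //= edges_z addnC leq_add2l.
  by apply: leq_sum => y _.
have sum_h' : \sum_y h' y <= \sum_y h y + #|oball D z (h z)|.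
  rewrite -sum_nat_mem -big_split; apply: leq_sum => y _.
  exact: raise_heightS_leq.
by lia.
Qed.

End ValidRaise.

Definition make_room (M : finType) (s : config M) (z : M) : config M :=
  if has_room s z then s else raise s z (height s z).+1.

Lemma extends_make_room (M : finType) (s : config M) z :
  extends s (make_room s z).
Proof.
by rewrite /make_room; case: ifP => [_ x y|_]; last exact: extends_raise.
Qed.

Section ValidMakeRoom.
Variables (M : finType) (L : nat) (s : config M).
Hypothesis s_valid : valid L s.

Lemma valid_make_room z : valid L (make_room s z).
Proof. by rewrite /make_room; case: ifP => // _; apply: valid_raise. Qed.

Lemma has_room_make_room z : has_room (make_room s z) z.
Proof.
rewrite /make_room; case: ifP => // _; apply: (has_room_raise_lt s_valid).
exact/leq_raise_height_center/(valid_metric s_valid).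
Qed.

Lemma has_room_make_room_mono z x : has_room s x -> has_room (make_room s z) x.
Proof.
by rewrite /make_room; case: ifP => // _; apply: (has_room_raise s_valid).
Qed.

Lemma potential_make_room z : potential (make_room s z) <= potential s.
Proof.
rewrite /make_room; case: ifP => // /negbT; exact: (potential_raise s_valid).
Qed.

End ValidMakeRoom.

(** ** Recording answers *)

Definition add_edge (M : finType) (h : M -> nat) (E : M -> nat -> {set M})
    (a b x : M) (k : nat) : {set M} :=
  E x k :|:
  [set y | (k == h x) && (((x, y) == (a, b)) || ((x, y) == (b, a)))].

Lemma add_edgeC (M : finType) h (E : M -> nat -> {set M}) a b x k :
  add_edge h E a b x k = add_edge h E b a x k.
Proof. by congr (_ :|: _); apply/setP => y; rewrite !inE orbC. Qed.

Lemma card_add_edge (M : finType) h (E : M -> nat -> {set M}) a b x k :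
  #|add_edge h E a b x k| <= #|E x k| + ((k == h x) && (x \in pred2 a b)).
Proof.
apply: leq_trans (leq_card_setU _ _) _; rewrite leq_add2l.
case: (k == h x) => /=; last by rewrite eq_card0 // => y; rewrite inE.
rewrite inE; have [->|nxa] := eqVneq x a.
  rewrite -[leqRHS](cards1 b) subset_leq_card //; apply/subsetP => y.
  by rewrite !inE !xpair_eqE eqxx /= => /orP[//|/andP[/eqP-> //]].
have [->|nxb] := eqVneq x b.
  rewrite -[leqRHS](cards1 a) subset_leq_card //; apply/subsetP => y.
  by rewrite !inE !xpair_eqE eqxx /= => /orP[/andP[/eqP-> //]|].
rewrite eq_card0 // => y.
by rewrite !inE !xpair_eqE (negbTE nxa) (negbTE nxb).
Qed.

Lemma steps_along_via (M : finType) L (D : M -> M -> nat) h E a b w x y :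
    steps_along L D E -> D x x = 0 -> x != y -> h a < w ->
    link D a b w x y = D x a + w + D b y -> link D a b w x y < L ->
  exists k, exists2 z, z \in add_edge h E a b x k &
    link D a b w z y + k < link D a b w x y.
Proof.
move=> step Dxx nxy ha_lt via ltL; rewrite via.
have [xa|nxa] := eqVneq x a.
  exists (h a), b; first by rewrite !inE xa !eqxx orbT.
  by have := leq_link D a b w b y; lia.
have [|k [z zE ltz]] := step x a nxa; first by lia.
exists k, z; first by rewrite inE zE.
by have := leq_link_via D a b w z y; lia.
Qed.

Lemma steps_along_link (M : finType) L (D : M -> M -> nat) h E a b :
    nat_metric D -> height_function D h -> steps_along L D E ->
  steps_along L (link D a b (hub_dist D h a b)) (add_edge h E a b).
Proof.
move=> D_metric [h_gt0 _] step x y nxy; set w := hub_dist D h a b => ltL.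
have [_ D_sym D_tri] := D_metric; have Dxx := nat_distxx x D_metric.
have [le_D|lt_D] := leqP (D x y) (link D a b w x y).
  have [|k [z zE ltz]] := step x y nxy; first exact: leq_ltn_trans ltL.
  exists k, z; first by rewrite inE zE.
  apply: leq_trans le_D; apply: leq_ltn_trans ltz.
  by rewrite leq_add2r leq_link.
have w_eq : w = h a + h b.
  move: lt_D (D_tri x a y) (D_tri x b y) (D_tri a b y) (D_tri b a y).
  by move: (D_sym a b); rewrite /link /w /hub_dist; lia.
have [ha_lt hb_lt] : h a < w /\ h b < w by move: (h_gt0 a) (h_gt0 b); lia.
have [via|via] : link D a b w x y = D x a + w + D b y \/
    link D a b w x y = D x b + w + D a y by move: lt_D; rewrite /link; lia.
- exact: (steps_along_via step Dxx nxy ha_lt).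
- rewrite linkC in via ltL *.
  have [k [z zE ltz]] := steps_along_via step Dxx nxy hb_lt via ltL.
  by exists k, z; rewrite 1?add_edgeC 1?linkC.
Qed.

Definition join (M : finType) (s : config M) (a b : M) : config M :=
  Config (link (base_dist s) a b (hub_dist (base_dist s) (height s) a b))
    (height s) (add_edge (height s) (edges s) a b).

Lemma potential_join (M : finType) (s : config M) a b :
  potential (join s a b) <= potential s + 2.
Proof.
apply: (@leq_trans (potential s + #|pred2 a b|)); last first.
  by rewrite leq_add2l card2; case: (a != b).
rewrite -sum_nat_mem -big_split; apply: leq_sum => x _ /=.
rewrite -addnA leq_add2l; apply: leq_trans (card_add_edge _ _ _ _ _ _) _.
by rewrite eqxx.
Qed.

Section ValidJoin.
Variables (M : finType) (L : nat) (s : config M) (a b : M).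
Hypothesis s_valid : valid L s.

Lemma valid_join : has_room s a -> has_room s b -> valid L (join s a b).
Proof.
case: s_valid => D_metric h_height step deg above room_a room_b.
have [_ hub_lip] := height_function_hub_dist h_height.
have hub_metric := nat_metric_hub_dist D_metric h_height.
split=> /=.
- apply: nat_metric_link => // /eqP.
  by rewrite (nat_dist_eq0 hub_metric) => /eqP.
- by apply: height_function_link; rewrite // (nat_dist_sym hub_metric).
- exact: steps_along_link.
- move=> x k; apply: leq_trans (subset_leq_card (sub_oball_link _ _ _ _ _ _)).
  apply: leq_trans (card_add_edge _ _ _ _ _ _) _.
  case: eqP => [->|_]; last by rewrite addn0.
  by have [/pred2P[]->|_] := boolP (x \in pred2 a b); rewrite ?addn1 ?addn0.
- move=> x k ltk; rewrite /add_edge above // set0U.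
  by apply/setP => y; rewrite !inE gtn_eqF.
Qed.

Lemma extends_join : extends s (join s a b).
Proof.
case: s_valid => D_metric h_height _ _ _ x y sxy.
by rewrite /settled /= !link_hub_dist_settled.
Qed.

Lemma settled_join : settled (base_dist (join s a b)) (height (join s a b)) a b.
Proof.
have Dxx x := nat_distxx x (valid_metric s_valid).
rewrite /settled /=; apply: leq_trans (leq_link_via _ _ _ _ _ _) _.
by rewrite !Dxx addn0 geq_minr.
Qed.

End ValidJoin.

Definition answer (M : finType) (s : config M) (a b : M) : config M :=
  join (make_room (make_room s a) b) a b.

Section ValidAnswer.
Variables (M : finType) (L : nat) (s : config M) (a b : M).
Hypothesis s_valid : valid L s.

Let valid_a := valid_make_room s_valid a.
Let valid_ab := valid_make_room valid_a b.

Lemma valid_answer : valid L (answer s a b).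
Proof.
apply: valid_join => //; last exact: (has_room_make_room valid_a).
exact/(has_room_make_room_mono valid_a)/(has_room_make_room s_valid).
Qed.

Lemma potential_answer : potential (answer s a b) <= potential s + 2.
Proof.
apply: leq_trans (potential_join _ _ _) _; rewrite leq_add2r.
apply: leq_trans (potential_make_room valid_a b) _.
exact: potential_make_room s_valid a.
Qed.

Lemma extends_answer : extends s (answer s a b).
Proof.
have ext_room :=
  extends_trans (@extends_make_room _ s a) (@extends_make_room _ _ b).
by apply: extends_trans ext_room _; apply: extends_join valid_ab.
Qed.

Lemma settled_answer :
  settled (base_dist (answer s a b)) (height (answer s a b)) a b.
Proof. exact: settled_join valid_ab. Qed.

End ValidAnswer.

(** ** Playing against an algorithm *)

Fixpoint play (R : realType) (M : finType) (L : nat) (s : config M)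
    (t : query_tree R M) : config M :=
  match t with
  | Output p => raise s p L
  | Query a b next =>
    let s' := answer s a b in play L s' (next (base_dist s' a b)%:R%R)
  end.

Definition true_dist (R : realType) (M : finType) (s : config M) (x y : M)
  : R := (hub_dist (base_dist s) (height s) x y)%:R%R.

Section Play.
Variables (R : realType) (M : finType) (L : nat).
Implicit Types (s : config M) (t : query_tree R M).

Lemma valid_play s t : valid L s -> valid L (play L s t).
Proof.
elim: t s => [p|a b next IH] s s_valid /=; first exact: valid_raise.
exact/IH/valid_answer.
Qed.

Lemma extends_play s t : valid L s -> extends s (play L s t).
Proof.
elim: t s => [p|a b next IH] s s_valid /=; first exact: extends_raise.
have s_ext := extends_answer a b s_valid.
by apply: extends_trans s_ext _; apply: IH (valid_answer a b s_valid).
Qed.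

Lemma true_dist_play_answer s a b t :
    valid L s ->
  true_dist R (play L (answer s a b) t) a b =
    (base_dist (answer s a b) a b)%:R%R.
Proof.
move=> s_valid; rewrite /true_dist.
have [<- settled_ab] :=
  extends_play t (valid_answer a b s_valid) (settled_answer a b s_valid).
by rewrite hub_dist_settled.
Qed.

Lemma leq_height_output_play s t :
  valid L s -> L <= height (play L s t) (output t (true_dist R (play L s t))).
Proof.
elim: t s => [p|a b next IH] s s_valid /=.
  exact/leq_raise_height_center/(valid_metric s_valid).
by rewrite true_dist_play_answer //; apply/IH/valid_answer.
Qed.

Lemma sum_height_play s t :
    valid L s ->
  \sum_x height (play L s t) x <=
    potential s + 2 * num_queries t (true_dist R (play L s t)) + L * 4 ^ L.
Proof.
elim: t s => [p|a b next IH] s s_valid /=.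
  rewrite muln0 addn0; apply: leq_trans (sum_raise_height _ _ _ _) _.
  apply: leq_add; first by apply: leq_sum => x _; apply: leq_addr.
  have [_ _ steps deg _] := s_valid.
  by rewrite leq_mul2l (card_oball_leq_exp4 _ steps) ?orbT.
rewrite true_dist_play_answer //.
apply: leq_trans (IH _ _ (valid_answer a b s_valid)) _.
by rewrite leq_add2r mulnS addnA leq_add2r (potential_answer a b s_valid).
Qed.

Lemma is_metric_true_dist s : valid L s -> is_metric (@true_dist R M s).
Proof.
by case=> D_metric h_height _ _ _; apply/is_metric_natr/nat_metric_hub_dist.
Qed.

End Play.

Local Open Scope ring_scope.

(** * Costs *)

Section Cost.
Variables (R : realType) (M : finType).
Implicit Types (d : M -> M -> R) (p : M).

Lemma cost_gt0 d p : is_metric d -> (1 < #|M|)%N -> 0 < cost d p.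
Proof.
move=> [d_ge0 d_eq0 _ _] /card_gt1P [x [y [_ _ nxy]]].
have [q npq] : exists q, p != q.
  by have [->|] := eqVneq p x; [exists y | exists x].
rewrite /cost (bigD1 q) //= ltr_pwDl ?sumr_ge0 // lt_neqAle d_ge0 andbT eq_sym.
by apply: contra npq => /eqP /d_eq0 ->.
Qed.

Lemma min_cost_gt0 d p : is_metric d -> (1 < #|M|)%N -> 0 < min_cost d p.
Proof. by move=> metric M_gt1; apply: lt_bigmin => [|q _]; apply: cost_gt0. Qed.

Lemma card_min_cost_le d p : #|M|%:R * min_cost d p <= \sum_q cost d q.
Proof.
by rewrite mulr_natl -sumr_const; apply: ler_sum => q _; apply: bigmin_le_cond.
Qed.

Lemma cost_natr (D : M -> M -> nat) p :
  cost (fun x y => (D x y)%:R : R) p = (\sum_y D p y)%N%:R.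
Proof. by rewrite natr_sum. Qed.

Lemma min_cost_true_dist (s : config M) p :
  min_cost (true_dist R s) p <= (2 * \sum_x height s x)%N%:R.
Proof.
have M_gt0 : 0 < #|M|%:R :> R by rewrite ltr0n; apply/card_gt0P; exists p.
rewrite -(ler_pM2l M_gt0); apply: le_trans (card_min_cost_le _ _) _.
under [leLHS]eq_bigr do rewrite [cost _ _]cost_natr.
rewrite -natr_sum -natrM ler_nat.
apply: (@leq_trans (\sum_q \sum_y (height s q + height s y))%N).
  by apply: leq_sum => q _; apply: leq_sum => y _; apply: geq_minr.
under eq_bigr => q _ do rewrite big_split /= sum_nat_const.
by rewrite big_split /= -big_distrr /= sum_nat_const mulnCA mul2n -addnn.
Qed.

Lemma cost_natr_ge (D : M -> M -> nat) p r :
  (r * (#|M| - #|oball D p r|))%N%:R <= cost (fun x y => (D x y)%:R : R) p.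
Proof.
rewrite cost_natr ler_nat -[oball D p r]setCK -cardsCs mulnC -sum_nat_const.
by rewrite big_mkcond; apply: leq_sum => y _; rewrite !inE; case: ifP; lia.
Qed.

End Cost.

(** * The lower bound *)

Lemma play_cost_ratio (R : realType) (M : finType) (t : query_tree R M) C L :
    let d := true_dist R (play L (init M L) t) in
    let p := output t d in
    (0 < L)%N -> (8 ^ L <= #|M|)%N -> (num_queries t d <= C * #|M|)%N ->
  L%:R * min_cost d p <= (8 * C.+1)%:R * cost d p.
Proof.
set s := play _ _ _ => d p L_gt0 exp8_le queries.
have init_valid := valid_init M L_gt0.
have s_valid : valid L s := valid_play t init_valid.
set n := #|M| in exp8_le queries.
have exp8E : (8 ^ L = 2 ^ L * 4 ^ L)%N by rewrite -expnMn.
have L_lt_exp2 : (L < 2 ^ L)%N by apply: ltn_expl.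
have L_exp4_le : (L * 4 ^ L <= n)%N.
  by apply: leq_trans exp8_le; rewrite exp8E leq_mul2r ltnW ?orbT.
have double_exp4_le : (2 * 4 ^ L <= n)%N.
  apply: leq_trans exp8_le; rewrite exp8E leq_mul2r.
  by rewrite (leq_ltn_trans L_gt0 L_lt_exp2) orbT.
have sum_h : (\sum_x height s x <= 2 * C.+1 * n)%N.
  apply: leq_trans (sum_height_play t init_valid) _.
  by rewrite potential_init -/s -/d -/n; lia.
have far : (n <= 2 * (n - #|oball (hub_dist (base_dist s) (height s)) p L|))%N.
  rewrite oball_hub_dist; last exact: leq_height_output_play.
  have [_ _ steps deg _] := s_valid.
  by have := card_oball_leq_exp4 p steps deg (leqnn L); lia.
apply: (@le_trans _ _ (L * (4 * C.+1 * n))%:R).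
  rewrite natrM ler_wpM2l // (le_trans (min_cost_true_dist _ _ _)) // ler_nat.
  by lia.
apply: le_trans (ler_wpM2l (ler0n _ _) (cost_natr_ge _ _ p L)).
rewrite -natrM ler_nat -/n.
by have := leq_mul (leqnn (L * (4 * C.+1))) far; lia.
Qed.

Lemma approximate_at_trunc_log (R : realType) (A : algorithm R) C n c :
    (7 < n)%N ->
    (forall (M : finType) (M_gt0 : (0 < #|M|)%N) (d : M -> M -> R),
      #|M| = n -> is_metric d -> (num_queries (A M M_gt0) d <= C * #|M|)%N) ->
    approximate_at A n c ->
  (trunc_log 8 n)%:R <= (8 * C.+1)%:R * c.
Proof.
set L := trunc_log 8 n => n_gt7 queries approx.
have L_gt0 : (0 < L)%N by rewrite trunc_log_gt0.
have M_gt0 : (0 < #|'I_n|)%N by rewrite card_ord; lia.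
pose d := true_dist R (play L (init 'I_n L) (A _ M_gt0)).
have metric : is_metric d.
  exact: is_metric_true_dist (valid_play _ (valid_init _ L_gt0)).
pose p := output (A _ M_gt0) d.
have min_gt0 : 0 < min_cost d p.
  by apply: min_cost_gt0; rewrite ?card_ord //; lia.
rewrite -(ler_pM2r min_gt0) -mulrA.
have ratio : L%:R * min_cost d p <= (8 * C.+1)%:R * cost d p.
  apply: play_cost_ratio => //; first by rewrite card_ord trunc_logP //; lia.
  exact: queries (card_ord n) metric.
apply: le_trans ratio _; rewrite ler_wpM2l //.
by apply: approx; rewrite ?card_ord.
Qed.

Lemma approximate_at_ge1 (R : realType) (A : algorithm R) n c :
  (1 < n)%N -> approximate_at A n c -> 1 <= c.
Proof.
move=> n_gt1 approx; have M_gt0 : (0 < #|'I_n|)%N by rewrite card_ord ltnW.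
pose d (x y : 'I_n) : R := (uniform_dist 1 x y)%:R.
have metric : is_metric d by apply/is_metric_natr/nat_metric_uniform_dist.
pose p := output (A _ M_gt0) d.
have min_gt0 : 0 < min_cost d p by apply: min_cost_gt0; rewrite ?card_ord.
rewrite -(ler_pM2r min_gt0) mul1r; apply: le_trans (approx _ M_gt0 d _ metric).
  exact: bigmin_le_id.
exact: card_ord.
Qed.

Lemma ln_le_trunc_log (R : realType) (b n : nat) :
  (1 < b)%N -> (0 < n)%N -> ln n%:R <= ln b%:R * (trunc_log b n).+1%:R :> R.
Proof.
move=> b_gt1 n_gt0; have b_gt0 := ltnW b_gt1.
rewrite mulr_natr -lnXn ?ltr0n // -natrX.
rewrite ler_ln ?posrE ?ltr0n ?expn_gt0 ?b_gt0 // ler_nat.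
by rewrite ltnW // trunc_log_ltn.
Qed.

Lemma approximate_at_ln (R : realType) (A : algorithm R) :
    makes_linear_queries A ->
  exists2 K : R, 0 < K &
    forall n c, (1 < n)%N -> approximate_at A n c -> ln n%:R <= K * c.
Proof.
move=> [C [N queries]].
pose small : R := ln (N + 8)%:R; pose large : R := ln 8%:R * (16 * C.+1)%:R.
have small_gt0 : 0 < small by rewrite ln_gt0 // ltr1n; lia.
have large_gt0 : 0 < large by rewrite mulr_gt0 ?ln_gt0 ?ltr1n ?ltr0n.
exists (small + large) => [|n c n_gt1 approx]; first exact: addr_gt0.
have c_ge1 := approximate_at_ge1 n_gt1 approx.
have c_ge0 : 0 <= c by apply: le_trans c_ge1.
have small_le : small <= small * c by rewrite ler_peMr // ltW.
have large_ge0 : 0 <= large * c by rewrite mulr_ge0 // ltW.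
rewrite mulrDl; have [ltN|geN] := ltnP n (N + 8).
  have ln_le : ln n%:R <= small by rewrite ler_ln ?posrE ?ltr0n ?ler_nat; lia.
  by apply: le_trans ln_le (le_trans small_le _); rewrite lerDl.
have L_gt0 : (0 < trunc_log 8 n)%N by rewrite trunc_log_gt0; lia.
have log_le : (trunc_log 8 n)%:R <= (8 * C.+1)%:R * c.
  apply: approximate_at_trunc_log approx; first by lia.
  by move=> M M_gt0 d cardM; apply: queries; rewrite cardM; lia.
apply: (@le_trans _ _ (large * c)); last first.
  by rewrite lerDr (le_trans _ small_le) // ltW.
apply: le_trans (ln_le_trunc_log R (isT : 1 < 8)%N (ltnW n_gt1)) _.
rewrite -mulrA ler_wpM2l ?ln_ge0 ?ler1n //.
apply: (@le_trans _ _ (2 * (trunc_log 8 n)%:R)).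
  by rewrite -natrM ler_nat; lia.
by move: log_le; rewrite !natrM; lra.
Qed.

Theorem theorem18 (R : realType) (A : algorithm R)
    (A_linear : makes_linear_queries A) :
  exists delta : R, 0 < delta /\
    forall n : nat, (2 <= n)%N -> ~ approximate_at A n (delta * ln n%:R).
Proof.
have [K K_gt0 ln_le] := approximate_at_ln A_linear.
exists (2 * K)^-1; split=> [|n n_gt1 approx].
  by rewrite invr_gt0 mulr_gt0.
have lnn_gt0 : 0 < ln n%:R :> R by rewrite ln_gt0 // ltr1n.
have := ln_le n _ n_gt1 approx.
have -> : K * ((2 * K)^-1 * ln n%:R) = ln n%:R / 2 by field; rewrite gt_eqF.
by lra.
Qed.
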